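(* Let $v$ be a simplicial vertex of degree at least one in a graph $G$, and let $w$ be a neighbor of $v$. Then $\mathcal{A}(G)>\mathcal{A}(G-vw)$.
   Context: All graphs are finite, simple and undirected. A coloring of a graph $G$ assigns colors to its vertices so that adjacent vertices receive different colors; two colorings are equivalent if they induce the same partition of the vertex set into color classes. $S(G,k)$ denotes the number of non-equivalent colorings of $G$ using exactly $k$ colors. Set $\mathcal{B}(G)=\sum_{k\ge1}S(G,k)$, $\mathcal{T}(G)=\sum_{k\ge1}kS(G,k)$ and $\mathcal{A}(G)=\mathcal{T}(G)/\mathcal{B}(G)$. A vertex is simplicial if its neighbors induce a clique. $G-vw$ denotes the graph obtained from $G$ by removing the edge $vw$. *)

(* Defs.v *)
(* A simple graph is a symmetric irreflexive relation on a
   finType of vertices. *)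
From mathcomp Require Import all_boot all_order all_algebra.

Set Implicit Arguments.
Unset Strict Implicit.
Unset Printing Implicit Defensive.

Import Order.TTheory GRing.Theory Num.Theory.

Section Graphs.

Variable T : finType.
Implicit Types (e : rel T) (v w : T) (k : nat).

Definition neighbors e v : {set T} := [set x | e v x].

Definition degree e v : nat := #|neighbors e v|.

Definition clique e (A : {set T}) : Prop :=
  {in A &, forall x y, x != y -> e x y}.

Definition simplicial e v : Prop := clique e (neighbors e v).

Definition del_edge e v w : rel T :=
  fun x y => e x y && ([set x; y] != [set v; w]).

Lemma del_edge_sym e v w : symmetric e -> symmetric (del_edge e v w).
Proof. by move=> es x y; rewrite /del_edge es setUC. Qed.

Lemma del_edge_irr e v w : irreflexive e -> irreflexive (del_edge e v w).
Proof. by move=> ei x; rewrite /del_edge ei. Qed.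

Definition proper_coloring e k (c : {ffun T -> 'I_k}) : bool :=
  [forall x, forall y, e x y ==> (c x != c y)].

Definition uses_all_colors k (c : {ffun T -> 'I_k}) : bool :=
  [forall i, exists x, c x == i].

(* The palette is 'I_k: up to equivalence this covers all colorings using
   exactly k colors, whatever the colors are. *)
Definition colorings e k : {set {ffun T -> 'I_k}} :=
  [set c | proper_coloring e c & uses_all_colors c].

Definition color_classes k (c : {ffun T -> 'I_k}) : {set {set T}} :=
  preim_partition c [set: T].

Definition equiv_colorings k (c d : {ffun T -> 'I_k}) : bool :=
  color_classes c == color_classes d.

Definition nb_colorings e k : nat :=
  #|equivalence_partition (@equiv_colorings k) (colorings e k)|.

(* Justifies truncating the sums over k >= 1 below at #|T|. *)
Lemma nb_colorings_gt_card e k : #|T| < k -> nb_colorings e k = 0.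
Proof.
move=> ltTk; rewrite /nb_colorings.
suff -> : colorings e k = set0 by rewrite /equivalence_partition imset0 cards0.
apply/setP=> c; rewrite !inE; apply/negbTE/negP=> /andP[_ /forallP c_onto].
have : k <= #|T|; last by rewrite leqNgt ltTk.
rewrite -[k]card_ord; apply: leq_trans (leq_image_card c T).
apply/subset_leq_card/subsetP=> i _.
by have /existsP[x /eqP <-] := c_onto i; apply: image_f.
Qed.

Definition total_colorings e : nat := \sum_(1 <= k < #|T|.+1) nb_colorings e k.

Definition total_colors e : nat :=
  \sum_(1 <= k < #|T|.+1) k * nb_colorings e k.

Definition avg_colors e : rat :=
  ((total_colors e)%:R / (total_colorings e)%:R)%R.

End Graphs.

(* Main.v *)
(* Let H = G - v and let d be the degree of v.  A partition of G into
   independent sets arises from a unique one Q of H, by putting v either in a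
   new block or in one of the |Q| - d blocks avoiding the clique N(v).  With
   b, t, s the sums of 1, |Q|, |Q|^2 over all Q, this gives
   B(G) + d b = b + t and T(G) + d t = b + t + s.  Deleting vw keeps v
   simplicial and only lowers d by one, so B(G - vw) = B(G) + b and
   T(G - vw) = T(G) + t.  The claim becomes t B(G) < b T(G), which is
   t^2 < b s + b^2, a consequence of Cauchy-Schwarz. *)
Require Import Defs.
From mathcomp Require Import all_boot all_order all_algebra.
From mathcomp Require Import zify.

Set Implicit Arguments.
Unset Strict Implicit.
Unset Printing Implicit Defensive.

(** * Adding a vertex to a set partition and removing it again *)

Lemma setD1_id (T : finType) (A : {set T}) (x : T) : x \notin A -> A :\ x = A.
Proof. by move=> xA; apply/setDidPl; rewrite disjoint_sym disjoints1. Qed.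

Section Attach.

Variables (T : finType) (v : T).
Implicit Types (P Q : {set {set T}}) (A D : {set T}).

(* [A = set0] encodes adding [v] as a new singleton block. *)
Definition attach Q A : {set {set T}} := (v |: A) |: (Q :\ A).

Definition detach_block P : {set T} := pblock P v :\ v.

(** If [v] is alone in its block, [detach_block P] is empty; the final [:\ set0] then drops it, so
    that no empty block remains. *)
Definition detach P : {set {set T}} :=
  (detach_block P |: (P :\ pblock P v)) :\ set0.

(** [Q :\ A] partitions [D :\: A], also when [A] is [set0], since [set0] is not a block of [Q]; then
    [v |: A] is a fresh disjoint block. *)
Lemma attach_partition Q A D :
    v \notin D -> partition Q D -> A \in set0 |: Q ->
  partition (attach Q A) (v |: D).
Proof.
move=> vD partQ; rewrite in_setU1 => QA.
have [sAD partQA] : A \subset D /\ partition (Q :\ A) (D :\: A).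
  have [->|A0] := eqVneq A set0.
    by rewrite sub0set setD0 (setD1_id (negbT (partition0 partQ))).
  move: QA; rewrite (negbTE A0) /= => QA.
  by rewrite partitionD1 // (partitionS partQ QA).
have -> : v |: D = (v |: A) :|: (D :\: A).
  by rewrite -setUA; congr (_ :|: _); rewrite -{1}(setID D A) (setIidPr sAD).
apply: partitionU1 => //; first by apply/set0Pn; exists v; rewrite setU11.
rewrite -setI_eq0; apply/eqP/setP=> x; rewrite !inE.
by have [->|] := eqVneq x v; rewrite ?(negbTE vD) ?andbF //= andbA andbN.
Qed.

Lemma attach_pblock Q A D :
    v \notin D -> partition Q D -> A \in set0 |: Q ->
  pblock (attach Q A) v = v |: A.
Proof.
move=> vD partQ QA; apply: def_pblock; rewrite ?setU11 //.
exact: (partition_trivIset (attach_partition vD partQ QA)).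
Qed.

Lemma notin_block Q D A :
  v \notin D -> partition Q D -> A \in set0 |: Q -> v \notin A.
Proof.
move=> vD partQ; rewrite in_setU1 => /predU1P[->|QA]; first by rewrite inE.
by apply: contra vD; apply: (subsetP (partitionS partQ QA)).
Qed.

Lemma setU1_notin Q A D :
  v \notin D -> partition Q D -> v |: A \notin Q.
Proof.
move=> vD partQ; apply: contra vD => QA.
by apply: (subsetP (partitionS partQ QA)); rewrite setU11.
Qed.

Lemma detach_block_attach Q A D :
    v \notin D -> partition Q D -> A \in set0 |: Q ->
  detach_block (attach Q A) = A.
Proof.
move=> vD partQ QA; rewrite /detach_block (attach_pblock vD partQ QA) setU1K //.
exact: (notin_block vD partQ QA).
Qed.

Lemma attachK Q A D :
    v \notin D -> partition Q D -> A \in set0 |: Q ->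
  detach (attach Q A) = Q.
Proof.
move=> vD partQ QA; rewrite /detach (detach_block_attach vD partQ QA).
rewrite (attach_pblock vD partQ QA) setU1K; last first.
  by rewrite inE negb_and (setU1_notin _ vD partQ) orbT.
apply/setP=> B; rewrite !inE; have Q0 := partition0 partQ.
move: QA; rewrite in_setU1 => QA.
have [->|B0] := eqVneq B set0; first by rewrite Q0.
have [eqBA|//] := eqVneq B A.
by move: QA; rewrite -eqBA (negbTE B0).
Qed.

Lemma card_attach Q A D :
    v \notin D -> partition Q D -> A \in set0 |: Q ->
  #|attach Q A| = (A == set0) + #|Q|.
Proof.
move=> vD partQ; rewrite in_setU1 cardsU1 inE negb_and (setU1_notin _ vD partQ) orbT /=.
have [->|A0 /= QA] := eqVneq A set0; last by rewrite [in RHS](cardsD1 A) QA.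
by rewrite (setD1_id (negbT (partition0 partQ))).
Qed.

Section Detach.

Variables (P : {set {set T}}) (D : {set T}).
Hypotheses (vD : v \notin D) (partP : partition P (v |: D)).

Let v_block : v \in pblock P v.
Proof. by rewrite mem_pblock (cover_partition partP) setU11. Qed.

Let pblock_in : pblock P v \in P.
Proof. by rewrite pblock_mem // (cover_partition partP) setU11. Qed.

Let partPB : partition (P :\ pblock P v) ((v |: D) :\: pblock P v).
Proof. exact: partitionD1. Qed.

Lemma detach_partition : partition (detach P) D.
Proof.
have sBD := partitionS partP pblock_in.
have -> : D = detach_block P :|: ((v |: D) :\: pblock P v).
  apply/setP=> x; rewrite /detach_block !inE.
  have := subsetP sBD x; rewrite !inE; have [->|_] := eqVneq x v.
    by rewrite v_block (negbTE vD).
  by case: (x \in pblock P v) => //= ->.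
rewrite /detach; have [->|A0] := eqVneq (detach_block P) set0.
  rewrite set0U setU1K //; last by rewrite (partition0 partPB).
have part' : partition (detach_block P |: (P :\ pblock P v))
   (detach_block P :|: ((v |: D) :\: pblock P v)).
  apply: partitionU1 => //; rewrite disjoint_sym.
  apply: disjointWr (subsetDl _ [set v]) _.
  by apply/setDidPl; rewrite setDDl setUid.
by rewrite (setD1_id (negbT (partition0 part'))).
Qed.

Lemma detach_block_in : detach_block P \in set0 |: detach P.
Proof. by rewrite !inE eqxx; case: eqP. Qed.

Lemma detachK : attach (detach P) (detach_block P) = P.
Proof.
(* Were the remainder already another block of [P], [attach] would delete that block too. But a
   nonempty block inside [pblock P v] equals it, and so would contain [v]. *)
have A_notin : detach_block P \notin P.
  apply/negP=> PA; have /set0Pn[y Ay] := partition_neq0 partP PA.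
  have tiP := partition_trivIset partP.
  have yB : y \in pblock P v by move: Ay; rewrite inE => /andP[].
  have eqAB : detach_block P = pblock P v.
    by rewrite -(def_pblock tiP PA Ay) (same_pblock tiP yB).
  by have := v_block; rewrite -eqAB !inE eqxx.
rewrite /attach setD1K //; apply/setP=> B; rewrite !inE.
have [->|_] := eqVneq B (pblock P v); first by rewrite pblock_in.
have [->|_] := eqVneq B (detach_block P); first by rewrite (negbTE A_notin).
by have [->|] := eqVneq B set0; rewrite // (partition0 partP).
Qed.

End Detach.

End Attach.

(** * Colorings up to equivalence as partitions into independent sets *)

Lemma card_preim_partition (T : finType) (rT : finType) (f : T -> rT) (D : {set T}) :
  #|preim_partition f D| = #|f @: D|.
Proof.
pose g (y : rT) := [set x in D | y == f x].
have -> : preim_partition f D = g @: (f @: D) by rewrite -imset_comp.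
apply: card_in_imset => _ y2 /imsetP[x Dx ->] _ eq_g.
have : x \in g (f x) by rewrite inE Dx eqxx.
by rewrite eq_g inE => /andP[_ /eqP].
Qed.

Section StablePartitions.

Variable T : finType.
Implicit Types (e : rel T) (P Q : {set {set T}}) (A B D : {set T}) (v : T).

Definition independent e A : bool :=
  [forall x in A, forall y in A, ~~ e x y].

(** Taken relative to [D], so that [setT] gives G and [[set~ v]] gives G - v without changing the
    vertex type. *)
Definition stable_partitions e D : {set {set {set T}}} :=
  [set P | partition P D & [forall B in P, independent e B]].

Lemma independentP e A :
  reflect {in A &, forall x y, ~~ e x y} (independent e A).
Proof.
apply: (iffP 'forall_in_'forall_in_idP) => [indA x y Ax Ay|indA x Ax y Ay].
  exact: indA.
exact: indA.
Qed.

Lemma stable_partitionsP e P D :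
  reflect (partition P D /\ {in P, forall B, independent e B})
          (P \in stable_partitions e D).
Proof. by rewrite inE; apply: (iffP andP) => -[partP /forall_inP]. Qed.

Lemma mem_color_classes k (c : {ffun T -> 'I_k}) B :
  reflect (exists x, B = [set y | c x == c y]) (B \in color_classes c).
Proof.
apply: (iffP imsetP) => [[x _ ->]|[x ->]]; exists x => //;
  by apply/setP=> y; rewrite !inE.
Qed.

Lemma color_classes_stable e k (c : {ffun T -> 'I_k}) :
  (color_classes c \in stable_partitions e setT) = proper_coloring e c.
Proof.
apply/stable_partitionsP/'forall_'forall_implyP => [[_ stable_c] x y exy|proper_c].
  apply/eqP=> cxy.
  have /stable_c/independentP : [set y | c x == c y] \in color_classes c.
    by apply/mem_color_classes; exists x.
  by move/(_ x y); rewrite !inE cxy eqxx exy => /(_ isT isT).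
split=> [|_ /mem_color_classes[x ->]]; first exact: preim_partitionP.
apply/independentP=> y z; rewrite !inE => /eqP cxy /eqP cxz.
by apply/negP=> /proper_c; rewrite -cxy -cxz eqxx.
Qed.

Lemma card_color_classes k (c : {ffun T -> 'I_k}) :
  (#|color_classes c| == k) = uses_all_colors c.
Proof.
rewrite card_preim_partition; apply/eqP/'forall_existsP=> [card_c i|c_onto].
  have /imsetP[x _ ->] : i \in c @: setT; last by exists x.
  by have /eqP -> : c @: setT == setT; rewrite // eqEcard subsetT cardsT card_ord card_c /=.
rewrite -[RHS]card_ord -cardsT; congr #|pred_of_set _|.
by apply/setP=> i; rewrite !inE; have [x /eqP <-] := c_onto i; rewrite imset_f.
Qed.

(** Each vertex is colored by the rank of its block in an enumeration of [P]. *)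
Lemma partition_color_classes P :
  partition P setT -> exists c : {ffun T -> 'I_#|P|}, color_classes c = P.
Proof.
move=> partP; have Px x : pblock P x \in P.
  by rewrite pblock_mem // (cover_partition partP).
exists [ffun x => enum_rank_in (Px x) (pblock P x)].
rewrite -[RHS](preim_partition_pblock partP).
apply: eq_imset => x; apply/setP=> y; rewrite !inE !ffunE.
apply/eqP/eqP=> [/(congr1 enum_val)|eqxy]; first by rewrite !enum_rankK_in.
by apply: enum_val_inj; rewrite !enum_rankK_in.
Qed.

(** Equivalence of colorings is equality under [color_classes], so the equivalence classes are
    counted by the image of [colorings e k] under that map. *)
Lemma nb_coloringsE e k :
  nb_colorings e k = #|[set P in stable_partitions e setT | #|P| == k]|.
Proof.
rewrite [LHS]card_preim_partition; congr #|pred_of_set _|.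
apply/setP=> P; rewrite inE; apply/imsetP/andP=> [[c + ->]|[stP /eqP eqPk]].
  by rewrite inE color_classes_stable card_color_classes => /andP.
have [partP _] := stable_partitionsP _ _ _ stP.
have [c defP] := partition_color_classes partP; subst k.
exists c; rewrite // inE -(color_classes_stable e) -card_color_classes.
by rewrite defP stP eqxx.
Qed.

(** A constant [F] equal to 1 yields the number of colorings, the identity yields the total number
    of colors. *)
Lemma sum_nb_colorings e (F : nat -> nat) : 0 < #|T| ->
  \sum_(1 <= k < #|T|.+1) F k * nb_colorings e k =
  \sum_(P in stable_partitions e setT) F #|P|.
Proof.
move=> T_gt0.
have term_k k : F k * nb_colorings e k =
    \sum_(P in stable_partitions e setT | #|P| == k) F #|P|.
  rewrite nb_coloringsE mulnC -sum_nat_const; symmetry.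
  rewrite (eq_bigl (mem [set P in stable_partitions e setT | #|P| == k])).
    by apply: eq_bigr => P; rewrite !inE => /andP[_ /eqP ->].
  by move=> P; rewrite !inE.
rewrite (eq_bigr _ (fun k _ => term_k k)).
rewrite (exchange_big_dep (mem (stable_partitions e setT))) /=; last first.
  by move=> k P _ /andP[].
apply: eq_bigr => P /[dup] stP /stable_partitionsP[partP _].
under eq_bigl => k do rewrite stP /= eq_sym.
(* Each [P] is counted for the single index [k = #|P|], which lies between 1 and [#|T|]; the lower
   bound uses that [T] is nonempty. *)
rewrite big_nat1_eq ifT //.
rewrite ltnS -(preim_partition_pblock partP) card_preim_partition.
apply/andP; split; last by rewrite -cardsT leq_imset_card.
rewrite card_gt0; have [x _] := card_gt0P T_gt0.
by apply/set0Pn; exists (pblock P x); apply: imset_f.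
Qed.

(** The partition into singletons is stable because there are no loops. *)
Lemma exists_stable_partition e D :
  irreflexive e -> 0 < #|stable_partitions e D|.
Proof.
move=> e_irr; apply/card_gt0P; exists (preim_partition id D).
apply/stable_partitionsP; split=> [|_ /imsetP[x _ ->]].
  exact: preim_partitionP.
apply/independentP=> y z; rewrite !inE => /andP[_ /eqP <-] /andP[_ /eqP <-].
by rewrite e_irr.
Qed.

End StablePartitions.

(** * Extending stable partitions by a simplicial vertex *)

Section AddVertex.

Variables (T : finType) (e : rel T) (v : T) (D : {set T}).
Hypotheses (e_sym : symmetric e) (e_irr : irreflexive e) (vD : v \notin D).
Implicit Types (P Q : {set {set T}}) (A B : {set T}).

Lemma independentU1 A :
  independent e (v |: A) = independent e A && [disjoint A & neighbors e v].
Proof.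
apply/independentP/andP=> [indA|[/independentP indA disjA] x y].
  split; first by apply/independentP=> x y Ax Ay; apply: indA; rewrite setU1r.
  apply/pred0P=> x /=; apply/andP=> -[Ax]; rewrite inE; apply/negP.
  by rewrite indA ?setU11 ?setU1r.
have not_ev z : z \in A -> e v z = false.
  by move=> Az; have := disjointFr disjA Az; rewrite inE.
rewrite !in_setU1 => /predU1P[->|Ax] /predU1P[->|Ay].
- by rewrite e_irr.
- by rewrite not_ev.
- by rewrite e_sym not_ev.
- exact: indA.
Qed.

Lemma attach_stable Q A :
    partition Q D -> A \in set0 |: Q ->
  (attach v Q A \in stable_partitions e (v |: D)) =
  (Q \in stable_partitions e D) && [disjoint A & neighbors e v].
Proof.
move=> partQ QA; rewrite !inE partQ (attach_partition vD partQ QA) /=.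
apply/forall_inP/andP=> [indP|[/forall_inP indQ disjA] B].
  have := indP (v |: A); rewrite setU11 independentU1 => /(_ isT)/andP[indA ->].
  split=> //; apply/forall_inP=> B QB; have [->//|BA] := eqVneq B A.
  by apply: indP; rewrite !inE BA QB orbT.
rewrite !inE => /predU1P[->|/andP[_ /indQ//]].
rewrite independentU1 disjA andbT; move: QA; rewrite in_setU1.
case/predU1P=> [->|/indQ//]; by apply/independentP=> x y; rewrite inE.
Qed.

(** Adjacent vertices never share a block, so [pblock Q] is injective on the clique of neighbors,
    which therefore meets exactly [degree e v] blocks. *)
Lemma card_blocks_disjoint_neighbors Q :
    simplicial e v -> neighbors e v \subset D -> Q \in stable_partitions e D ->
  #|[set A in Q | [disjoint A & neighbors e v]]| + degree e v = #|Q|.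
Proof.
move=> v_simp sND /stable_partitionsP[partQ indQ]; set N := neighbors e v.
have tiQ := partition_trivIset partQ; have covQ := cover_partition partQ.
have N_cov x : x \in N -> x \in cover Q by rewrite covQ => /(subsetP sND).
have inj_block : {in N &, injective (pblock Q)}.
  move=> x y Nx Ny eqxy; apply/eqP/negPn/negP=> neq_xy.
  have /independentP/(_ x y) := indQ _ (pblock_mem (N_cov x Nx)).
  by rewrite {2}eqxy !mem_pblock !N_cov // v_simp // => /(_ isT isT).
rewrite /degree -/N -(card_in_imset inj_block) addnC.
rewrite -(cardsID [set A in Q | ~~ [disjoint A & N]] Q).
congr (_ + _); apply: eq_card=> A; rewrite !inE.
  apply/imsetP/idP=> [[x Nx ->]|].
    rewrite pblock_mem ?N_cov //=; apply/pred0Pn; exists x.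
    by rewrite /= mem_pblock N_cov.
  case/and3P=> _ QA /pred0Pn[x /andP[/= Ax Nx]].
  by exists x; rewrite // (def_pblock tiQ QA Ax).
by case: (A \in Q); rewrite ?andbF //= negbK andbT.
Qed.

(** A partition [Q] extends by a new singleton, giving [#|Q|.+1] blocks, or through one of
    [#|Q| - degree e v] blocks, keeping [#|Q|]. The degree term stands on the left to avoid
    truncated subtraction. *)
Lemma sum_stable_partitions_attach (F : nat -> nat) :
    simplicial e v -> neighbors e v \subset D ->
  \sum_(P in stable_partitions e (v |: D)) F #|P|
    + degree e v * \sum_(Q in stable_partitions e D) F #|Q| =
  \sum_(Q in stable_partitions e D) (F #|Q|.+1 + #|Q| * F #|Q|).
Proof.
move=> v_simp sND; set S := stable_partitions e D.
pose att (p : {set {set T}} * {set T}) := attach v p.1 p.2.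
rewrite (reindex_onto att (fun P => (detach v P, detach_block v P))); last first.
  by move=> P /stable_partitionsP[partP _]; exact: (detachK partP).
rewrite (eq_bigl (fun p => (p.1 \in S) &&
    ((p.2 \in set0 |: p.1) && [disjoint p.2 & neighbors e v]))); last first.
  (* The round-trip condition of the reindexing forces [Q] to partition [D] and [A] to be [set0] or
     a block of [Q], because [Q] and [A] come from detaching. *)
  case=> Q A /=; apply/andP/and3P=> [[stP /eqP[defQ defA]]|[stQ QA disjA]].
    have [partP _] := stable_partitionsP _ _ _ stP.
    have partQ := detach_partition vD partP; rewrite /att /= defQ in partQ.
    have QA := detach_block_in v (attach v Q A); rewrite defQ defA in QA.
    by move: stP; rewrite /att attach_stable //= => /andP[].
  have [partQ _] := stable_partitionsP _ _ _ stQ.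
  rewrite attach_stable // (attachK vD partQ QA) (detach_block_attach vD partQ QA).
  by rewrite stQ disjA.
rewrite -(pair_big_dep _
    (fun Q A => (A \in set0 |: Q) && [disjoint A & neighbors e v])
    (fun Q A => F #|attach v Q A|)) /=.
rewrite big_distrr -big_split /=; apply: eq_bigr => Q stQ.
have [partQ _] := stable_partitionsP _ _ _ stQ.
(* The term [A = set0] is the new singleton block; all others keep the number of blocks. *)
rewrite (bigD1 set0) /=; last by rewrite setU11 disjoints_subset sub0set.
rewrite (card_attach vD partQ) ?setU11 // eqxx -addnA; congr (_ + _).
rewrite -{2}(card_blocks_disjoint_neighbors v_simp sND stQ) mulnDl; congr (_ + _).
rewrite -sum_nat_const; apply: eq_big => [A|A /andP[/andP[QA _] A0]].
  rewrite !inE; have [->|_] := eqVneq A set0; last by rewrite andbT.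
  by rewrite (partition0 partQ) andbF.
by rewrite (card_attach vD partQ QA) (negbTE A0).
Qed.

End AddVertex.

(** After doubling, both sides are double sums over pairs, compared termwise by 2xy <= x^2 + y^2. *)
Lemma sum_Cauchy_Schwarz (I : finType) (S : {set I}) (F : I -> nat) :
  (\sum_(i in S) F i) ^ 2 <= #|S| * \sum_(i in S) F i ^ 2.
Proof.
rewrite -(leq_pmul2l (ltn0Sn 1)) [in leqRHS]mulnA.
have -> : 2 * (\sum_(i in S) F i) ^ 2 =
    \sum_(i in S) \sum_(j in S) 2 * (F i * F j).
  rewrite -mulnn big_distrlr /= big_distrr; apply: eq_bigr => i _.
  by rewrite big_distrr.
have -> : 2 * #|S| * \sum_(i in S) F i ^ 2 =
    \sum_(i in S) \sum_(j in S) (F i ^ 2 + F j ^ 2).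
  under [RHS]eq_bigr => i _ do rewrite big_split /= sum_nat_const.
  by rewrite big_split /= -big_distrr /= sum_nat_const -mulnA mul2n addnn.
by apply: leq_sum => i _; apply: leq_sum => j _; rewrite nat_Cauchy.
Qed.

(** * Effect of deleting an edge at [v] *)

Section DeleteEdge.

Variables (T : finType) (e : rel T) (v w : T).
Hypotheses (e_irr : irreflexive e).

Lemma del_edge_neighbors : neighbors (del_edge e v w) v = neighbors e v :\ w.
Proof.
apply/setP=> x; rewrite !inE /del_edge andbC; case evx: (e v x); last by rewrite !andbF.
rewrite !andbT; congr (~~ _); apply/eqP/eqP=> [/setP/(_ x)|-> //].
rewrite !inE eqxx orbT => /esym/orP[/eqP xv|/eqP//].
by rewrite xv e_irr in evx.
Qed.

(** The deleted edge ends at [v], which is not its own neighbor, so no edge among the remaining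
    neighbors is lost. *)
Lemma del_edge_simplicial : simplicial e v -> simplicial (del_edge e v w) v.
Proof.
move=> v_simp x y; rewrite del_edge_neighbors !in_setD1.
move=> /andP[xw ex] /andP[yw ey] xy; rewrite /del_edge v_simp //=.
apply/eqP=> /setP/(_ v); rewrite !inE eqxx /= => /orP[] /eqP v_eq.
  by rewrite -v_eq inE e_irr in ex.
by rewrite -v_eq inE e_irr in ey.
Qed.

(** Blocks inside [[set~ v]] contain no endpoint [v], so the deleted edge is invisible to them. Both
    graphs thus share the same b, t and s. *)
Lemma del_edge_stable_partitions :
  stable_partitions (del_edge e v w) [set~ v] = stable_partitions e [set~ v].
Proof.
apply/setP=> P; rewrite !inE; apply: andb_id2l => partP.
apply: eq_forallb_in => B PB; apply: eq_forallb_in => x Bx.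
apply: eq_forallb_in => y By; rewrite /del_edge.
have sB := subsetP (partitionS partP PB).
suff -> : [set x; y] != [set v; w] by rewrite andbT.
apply/eqP=> /setP/(_ v); rewrite !inE eqxx /= => /orP[] /eqP v_eq.
  by have := sB x Bx; rewrite -v_eq !inE eqxx.
by have := sB y By; rewrite -v_eq !inE eqxx.
Qed.

End DeleteEdge.

Theorem theorem7 (T : finType) (e : rel T)
    (e_sym : symmetric e) (e_irr : irreflexive e) (v w : T)
    (v_simplicial : simplicial e v) (v_deg : 1 <= degree e v)
    (w_neighbor : w \in neighbors e v) :
  (avg_colors e > avg_colors (del_edge e v w))%R.
Proof.
have T_gt0 : 0 < #|T| by apply/card_gt0P; exists v.
set e' := del_edge e v w.
have e'_sym : symmetric e' := del_edge_sym v w e_sym.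
have e'_irr : irreflexive e' := del_edge_irr v w e_irr.
have vV : v \notin [set~ v] by rewrite !inE eqxx.
have defT : v |: [set~ v] = setT by rewrite setUCr.
have sNV f : irreflexive f -> neighbors f v \subset [set~ v].
  move=> f_irr; apply/subsetP=> x; rewrite !inE.
  by apply: contraTneq => ->; rewrite f_irr.
have total_coloringsE (f : rel T) : total_colorings f =
    \sum_(P in stable_partitions f setT) 1.
  have /= <- := sum_nb_colorings f (fun=> 1) T_gt0; apply: eq_bigr => k _.
  by rewrite mul1n.
have total_colorsE (f : rel T) : total_colors f =
    \sum_(P in stable_partitions f setT) #|P|.
  exact: (sum_nb_colorings f id T_gt0).
have deg_e : degree e v = (degree e' v).+1.
  by rewrite /degree del_edge_neighbors // (cardsD1 w) w_neighbor.
have sum_e F :=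
  sum_stable_partitions_attach e_sym e_irr vV F v_simplicial (sNV e e_irr).
have eqB := sum_e (fun=> 1); have eqT := sum_e id.
have v_simplicial' : simplicial e' v by apply: del_edge_simplicial.
have sum_e' F :=
  sum_stable_partitions_attach e'_sym e'_irr vV F v_simplicial' (sNV _ e'_irr).
have eqB' := sum_e' (fun=> 1); have eqT' := sum_e' id.
rewrite defT del_edge_stable_partitions in eqB' eqT'.
rewrite defT deg_e in eqB eqT.
rewrite -total_coloringsE in eqB; rewrite -total_coloringsE in eqB'.
rewrite -total_colorsE in eqT; rewrite -total_colorsE in eqT'.
have B_gt0 : 0 < total_colorings e.
  by rewrite total_coloringsE sum1_card exists_stable_partition.
have B'_gt0 : 0 < total_colorings e'.
  by rewrite total_coloringsE sum1_card exists_stable_partition.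
have H_gt0 := exists_stable_partition [set~ v] e_irr.
have CS := sum_Cauchy_Schwarz (stable_partitions e [set~ v]) (fun Q => #|Q|).
(* The claim with its positive denominators cleared. *)
have : total_colors e' * total_colorings e <
    total_colors e * total_colorings e'.
  move: eqB eqT eqB' eqT' CS H_gt0.
  rewrite !big_split /= !sum1_card.
  under eq_bigr => Q _ do rewrite muln1.
  set H := stable_partitions e [set~ v].
  have -> : \sum_(Q in H) #|Q|.+1 = #|H| + \sum_(Q in H) #|Q|.
    by rewrite -sum1_card -big_split.
  have -> : \sum_(Q in H) #|Q| * #|Q| = \sum_(Q in H) #|Q| ^ 2.
    by apply: eq_bigr => Q _; rewrite mulnn.
  move: (total_colors e) (total_colorings e) (total_colors e') (total_colorings e').
  move: (degree e' v) #|H| (\sum_(Q in H) #|Q|) (\sum_(Q in H) #|Q| ^ 2).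
  (* Here [d] is the degree of [v] after the deletion, hence [d.+1] before it; [te], [be] belong to
     G and [te'], [be'] to G - vw. *)
  move=> d b t s te be te' be' eqB eqT eqB' eqT' CS b_gt0.
  have -> : te' = te + t by lia.
  have -> : be' = be + b by lia.
  rewrite mulnDl mulnDr ltn_add2l.
  (* What remains is [t * be < te * b]. Adding [d.+1 * b * t] to both sides removes the degree and
     leaves [t ^ 2 < b * s + b ^ 2]: Cauchy-Schwarz, made strict by [b > 0]. *)
  have eqtB : t * be + d.+1 * b * t = t * b + t ^ 2 by nia.
  have eqbT : te * b + d.+1 * b * t = t * b + b * s + b ^ 2 by nia.
  by nia.
rewrite /avg_colors Num.Theory.ltr_pdivrMr ?Num.Theory.ltr0n //.
rewrite GRing.mulrAC Num.Theory.ltr_pdivlMr ?Num.Theory.ltr0n //.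
by rewrite -!GRing.natrM Num.Theory.ltr_nat.
Qed.
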